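(* Let $U=\{f_0,\ldots,f_3\}$ be a basepoint free, generic, $4$-dimensional vector subspace of $R_{(a,1)}=H^0(\mathbb{P}^1\times\mathbb{P}^1,\mathcal{O}(a,1))$ and $\lambda_U:\mathbb{P}^1\times\mathbb{P}^1\to\mathbb{P}^3$ the regular map determined by $U$. Then the first map of the approximation complex $\mathcal{Z}$ in bidegree $\nu=(2a-1,0)$ is determined by two syzygies of $(f_0,\ldots,f_3)$ in bidegree $(a,0)$.
   Context: $k$ is an algebraically closed field of characteristic zero. $R=k[s,t,u,v]$ is the total coordinate ring of $\mathbb{P}^1\times\mathbb{P}^1$, bigraded by $\deg s=\deg t=(1,0)$, $\deg u=\deg v=(0,1)$. $U=\{f_0,\ldots,f_3\}$ denotes the vector space with basis $f_0,\ldots,f_3$; it is basepoint free if $f_0,\ldots,f_3$ have no common zero in $\mathbb{P}^1\times\mathbb{P}^1$. Convention on generic $U$: if $\mathbf b=\{b_1,\ldots,b_q\}$ is a basis of $R_{(a,1)}$, a generic choice of $U$ is one given by $\mathbf f=C\mathbf b$, where $\mathbf f=(f_0,\ldots,f_3)^T$ and $C$ is a $4\times q$ matrix over $k$ all of whose maximal minors are nonzero. A syzygy of $(f_0,\ldots,f_3)$ of bidegree $(\alpha,\beta)$ is a tuple $(s_0,\ldots,s_3)\in(R_{(\alpha,\beta)})^4$ with $\sum s_if_i=0$. Approximation complex: let $S=k[X,Y,Z,W]$ be the coordinate ring of $\mathbb{P}^3$ and let $d_i^f$ be the $i$-th differential of the Koszul complex over $R$ of $(f_0,\ldots,f_3)$.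 Then $\mathcal{Z}_i=\ker(d_i^f)\otimes_k S$, with differential $\mathcal{Z}_i\to\mathcal{Z}_{i-1}$ given by the differential of the Koszul complex of $(X,Y,Z,W)$. In bidegree $\nu$ (with respect to $R$), the first map is $(\mathcal{Z}_1)_\nu=\mathrm{Syz}(f_0,\ldots,f_3)_\nu\otimes_k S\to(\mathcal{Z}_0)_\nu=R_\nu\otimes_k S$, sending a syzygy $(s_0,\ldots,s_3)$ to $s_0X+s_1Y+s_2Z+s_3W$.
   Formalization: ''Generic'' is read as: C lies in some nonempty Zariski open set of 4×q matrices (depending on a and the basis b) and has all maximal minors nonzero; with the maximal-minor condition alone the claim fails, e.g. for a basepoint free U with a=2 that has a syzygy of bidegree (1,0). *)

(* Defs.v *)
From HB Require Import structures.
From mathcomp Require Import all_boot all_order all_algebra.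
From mathcomp Require Export mpoly.

Set Implicit Arguments.
Unset Strict Implicit.
Unset Printing Implicit Defensive.

Import GRing.Theory.
Local Open Scope ring_scope.

(* k[s,t,u,v], the variables s, t, u, v having indices 0, 1, 2, 3. *)
Notation coxring k := {mpoly k[4]}.

Definition vs {k : nzRingType} : coxring k := 'X_(inord 0).
Definition vt {k : nzRingType} : coxring k := 'X_(inord 1).

(* p lies in the graded piece R_(alpha,beta); in particular 0 does. *)
Definition bihomog (k : nzRingType) (d : nat * nat) (p : coxring k) : Prop :=
  forall m : 'X_{1..4}, m \in msupp p ->
    (m (inord 0) + m (inord 1) = d.1)%N /\ (m (inord 2) + m (inord 3) = d.2)%N.

(* b is a k-basis of R_d. *)
Definition bigraded_basis (k : nzRingType) (d : nat * nat) (q : nat)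
    (b : 'cV[coxring k]_q) : Prop :=
  (forall j, bihomog d (b j 0)) /\
  (forall p : coxring k, bihomog d p ->
     exists! c : 'rV[k]_q, p = \sum_(j < q) c 0 j *: b j 0).

Definition lin_indep (k : nzRingType) (n : nat) (f : 'cV[coxring k]_n) : Prop :=
  forall c : 'rV[k]_n, \sum_(i < n) c 0 i *: f i 0 = 0 -> c = 0.

(* The entries of f have no common zero in P^1 x P^1; a point of P^1 x P^1 is
   given by homogeneous coordinates x = (s,t,u,v), (s,t) <> 0, (u,v) <> 0. *)
Definition basepoint_free (k : comNzRingType) (n : nat) (f : 'cV[coxring k]_n)
    : Prop :=
  forall x : 'I_4 -> k,
    x (inord 0) != 0 \/ x (inord 1) != 0 ->
    x (inord 2) != 0 \/ x (inord 3) != 0 ->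
    exists i, (f i 0).@[x] != 0.

Definition maximal_minors_nonzero (k : comNzRingType) (m q : nat)
    (C : 'M[k]_(m, q)) : Prop :=
  forall g : 'I_m -> 'I_q, injective g -> \det (colsub g C) != 0.

(* Q holds for a generic matrix: for all matrices with nonzero maximal minors
   in some nonempty principal Zariski open subset of the affine space of
   m x q matrices over the infinite field k. *)
Definition for_generic (k : closedFieldType) (m q : nat)
    (Q : 'M[k]_(m, q) -> Prop) : Prop :=
  exists2 P : {mpoly k[m * q]}, P != 0 &
    forall C : 'M[k]_(m, q), maximal_minors_nonzero C ->
      P.@[fun i => mxvec C 0 i] != 0 -> Q C.

(* The column (f_0, ..., f_{m-1})^T = C b. *)
Definition combine (k : nzRingType) (m q : nat) (C : 'M[k]_(m, q))
    (b : 'cV[coxring k]_q) : 'cV[coxring k]_m :=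
  map_mx (@mpolyC 4 k) C *m b.

(* s is a syzygy of f of bidegree d: an element of Syz(f)_d = ker(d_1^f)_d. *)
Definition syzygy (k : comNzRingType) (f : 'cV[coxring k]_4) (d : nat * nat)
    (s : 'rV[coxring k]_4) : Prop :=
  (forall i, bihomog d (s 0 i)) /\ s *m f = 0.

(* The coordinate ring S of P^3; X, Y, Z, W have indices 0, 1, 2, 3. *)
Notation p3ring k := {mpoly k[4]}.

(* R (x)_k S, realised as R[X,Y,Z,W]; for a subspace V of R^n, V (x)_k S is the
   set of elements of R[X,Y,Z,W]^n all of whose coefficients lie in V. *)
Notation RS k := {mpoly (coxring k)[4]}.

Definition Sinj (k : comNzRingType) (c : p3ring k) : RS k :=
  map_mpoly (@mpolyC 4 k) c.

(* (Z_0)_nu = R_nu (x) S and (Z_1)_nu = Syz(f)_nu (x) S. *)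
Definition Z0 (k : comNzRingType) (nu : nat * nat) (T : RS k) : Prop :=
  forall m : 'X_{1..4}, bihomog nu T@_m.

Definition Z1 (k : comNzRingType) (f : 'cV[coxring k]_4) (nu : nat * nat)
    (T : 'rV[RS k]_4) : Prop :=
  forall m : 'X_{1..4}, syzygy f nu (map_mx (mcoeff m) T).

(* The differential Z_1 -> Z_0 of the approximation complex. *)
Definition first_map (k : comNzRingType) (T : 'rV[RS k]_4) : RS k :=
  \sum_(i < 4) T 0 i * 'X_i.

(* e is a basis of the free S-module (Z_1)_nu. *)
Definition Z1_basis (k : comNzRingType) (f : 'cV[coxring k]_4) (nu : nat * nat)
    (n p : nat) (e : 'I_n -> 'I_p -> 'rV[RS k]_4) : Prop :=
  (forall j i, Z1 f nu (e j i)) /\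
  (forall T, Z1 f nu T ->
     exists! c : 'M[p3ring k]_(n, p),
       T = \sum_(j < n) \sum_(i < p) Sinj (c j i) *: e j i).

(* The multiple s^i t^(a-1-i) sg of a syzygy sg, an element of R^4 (x) 1. *)
Definition syz_multiple (k : comNzRingType) (a : nat) (sg : 'rV[coxring k]_4)
    (i : 'I_a) : 'rV[RS k]_4 :=
  map_mx (@mpolyC 4 (coxring k)) ((vs ^+ i * vt ^+ (a.-1 - i)) *: sg).

(* (Z_1)_(2a-1,0) is S-free on the 2a products of the two syzygies sg 0, sg 1
   by the monomials s^i t^(a-1-i) of R_(a-1,0); in this basis the columns of the
   first map are the products of the linear forms
   sg_0 X + sg_1 Y + sg_2 Z + sg_3 W by the same monomials. *)
Definition first_map_determined_by (k : comNzRingType)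
    (f : 'cV[coxring k]_4) (a : nat) (sg : 'I_2 -> 'rV[coxring k]_4) : Prop :=
  Z1_basis f (2 * a - 1, 0)%N (fun j (i : 'I_a) => syz_multiple (sg j) i) /\
  forall (j : 'I_2) (i : 'I_a),
    Z0 (2 * a - 1, 0)%N (first_map (syz_multiple (sg j) i)) /\
    first_map (syz_multiple (sg j) i) =
      (vs ^+ i * vt ^+ (a.-1 - i)) *: \sum_(l < 4) sg j 0 l *: 'X_l.

(* Main.v *)
(** Writing f_i = p_i u + q_i v, the syzygies of bidegree (d,0) are the vectors
    of forms of degree d in s, t orthogonal to both p and q; setting t = 1, they
    become vectors of polynomials in x of degree at most d.  In degree d = a-1
    this is a square linear system, of size 4a, whose determinant is a
    polynomial in the coefficients of f that does not vanish at
    (s^a u, t^a u, s^a v, t^a v); so for generic f it is invertible.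

    Let K be the space of vectors w of k^4 orthogonal to the coefficients of
    s^a in p and q; since f has no base point over t = 0, dim K = 2.  Every w in
    K is the coefficient of x^a of a syzygy w x^a + lower terms: the lower terms
    solve the invertible system.  Lifting a basis of K gives two syzygies of
    degree a.  Their multiples by powers of x span the syzygies of any degree
    d >= a, because one can cancel the coefficient of x^d, which lies in K, and
    end with a syzygy of degree a-1, that is, with 0; and they are free because
    their leading coefficients are. *)

Require Import Defs.
From HB Require Import structures.
From mathcomp Require Import all_boot all_order all_algebra.

Import GRing.Theory.
Local Open Scope ring_scope.

Set Implicit Arguments.
Unset Strict Implicit.
Unset Printing Implicit Defensive.

(** * Determinants of linear families of matrices, and coefficients of polynomials *)

(** By linearity [L C] is the value at [C] of a matrix [D] of linear forms, so [P] is [\det D]. The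
    sizes are equal only by hypothesis because the later ones are [4 * a] and [2 * (a + a)]. *)
Lemma generic_row_free (k : fieldType) (p q m n : nat)
    (L : {linear 'M[k]_(p, q) -> 'M[k]_(m, n)}) :
  m = n ->
  exists P : {mpoly k[p * q]}, forall C : 'M[k]_(p, q),
    (P.@[fun i => mxvec C 0 i] != 0) = row_free (L C).
Proof.
move=> mn; case: n / mn L => L.
pose D : 'M[{mpoly k[p * q]}]_m := \sum_(i < p) \sum_(j < q)
  'X_(mxvec_index i j) *: map_mx (@mpolyC _ k) (L (delta_mx i j)).
exists (\det D) => C.
rewrite -det_map_mx row_free_unit unitmxE unitfE; congr (\det _ != 0).
rewrite [in RHS](matrix_sum_delta C) !linear_sum.
rewrite raddf_sum; apply: eq_bigr => i _.
rewrite linear_sum raddf_sum; apply: eq_bigr => j _.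
apply/matrixP=> x y.
by rewrite linearZ !mxE /= mevalM mevalXU mevalC mxvecE.
Qed.

Lemma rVpoly_sum (R : nzRingType) (d : nat) (v : 'rV[R]_d) :
  rVpoly v = \sum_i v 0 i *: 'X^i.
Proof.
rewrite {1}(row_sum_delta v) linear_sum; apply: eq_bigr => i _.
by rewrite linearZ /= rVpoly_delta.
Qed.

Lemma Xn_combination_eq0 (R : idomainType) (n : nat) (p1 p2 : {poly R}) :
  (size p2 <= n)%N -> p1 * 'X^n + p2 = 0 -> p1 = 0 /\ p2 = 0.
Proof.
move=> sp2 e; have p20 : p2 = 0.
  apply/polyP=> i; rewrite coef0; have [lt|le] := ltnP i n.
    have := congr1 (fun r : {poly R} => r`_i) e.
    by rewrite /= coefD coefMXn lt add0r coef0.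
  by rewrite nth_default // (leq_trans sp2).
split=> //; move: e; rewrite p20 addr0 => /eqP.
by rewrite mulf_eq0 (negbTE (monic_neq0 (monicXn _ _))) orbF => /eqP.
Qed.

Lemma coefM_top (R : nzRingType) (p q : {poly R}) (i j : nat) :
  (size p <= i.+1)%N -> (size q <= j.+1)%N -> (p * q)`_(i + j) = p`_i * q`_j.
Proof.
move=> sp sq; have lti : (i < (i + j).+1)%N by rewrite ltnS leq_addr.
rewrite coefM (bigD1 (Ordinal lti)) //= addKn big1 ?addr0 // => l ne.
have: (l != i :> nat) by apply: contraNneq ne => e; apply/eqP/val_inj.
rewrite neq_ltn => /orP[li|il]; last first.
  by rewrite (nth_default _ (leq_trans sp il)) mul0r.
by rewrite [q`_ _]nth_default ?mulr0 // (leq_trans sq) // ltn_subRL ltn_add2r.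
Qed.

(** * Kernels of polynomial matrices *)

Section PolynomialMatrices.

Variable k : fieldType.

Definition coefmx (m n : nat) (d : nat) (T : 'M[{poly k}]_(m, n)) : 'M[k]_(m, n) :=
  map_mx (fun p : {poly k} => p`_d) T.

(** The bound is on [size]: entries have degree less than [d], and [size_le 0] forces the zero
    matrix. *)
Definition size_le (m n : nat) (d : nat) (T : 'M[{poly k}]_(m, n)) : Prop :=
  forall i j, (size (T i j) <= d)%N.

Definition row_of_coefs (m d : nat) (r : 'M[k]_(m, d)) : 'rV[{poly k}]_m :=
  \row_i rVpoly (row i r).

Definition coefs_of_row (m d : nat) (u : 'rV[{poly k}]_m) : 'M[k]_(m, d) :=
  \matrix_(i, j) (u 0 i)`_j.

Lemma size_row_of_coefs m d (r : 'M[k]_(m, d)) : size_le d (row_of_coefs r).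
Proof. by move=> i j; rewrite mxE size_poly. Qed.

Lemma row_of_coefsK m d : cancel (@row_of_coefs m d) (@coefs_of_row m d).
Proof. by move=> r; apply/matrixP=> i j; rewrite !mxE coef_rVpoly_ord mxE. Qed.

Lemma coefs_of_rowK m d (u : 'rV[{poly k}]_m) :
  size_le d u -> row_of_coefs (coefs_of_row d u) = u.
Proof.
move=> su; apply/rowP=> i; rewrite mxE; apply/polyP=> n.
rewrite coef_rVpoly; case: insubP => [j _ <-|]; first by rewrite !mxE.
by rewrite -leqNgt => dn; rewrite nth_default // (leq_trans (su 0 i)).
Qed.

Lemma size_le_coefmx m n d (T : 'M[{poly k}]_(m, n)) :
  size_le d.+1 T -> coefmx d T = 0 -> size_le d T.
Proof.
move=> sT /matrixP T0 i j; apply/leq_sizeP => e; rewrite leq_eqVlt.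
case/orP=> [/eqP <-|de]; first by have := T0 i j; rewrite !mxE.
by rewrite nth_default // (leq_trans (sT i j)).
Qed.

Lemma coefmxM_top m n r i j (A : 'M[{poly k}]_(m, n)) (B : 'M_(n, r)) :
  size_le i.+1 A -> size_le j.+1 B ->
  coefmx (i + j) (A *m B) = coefmx i A *m coefmx j B.
Proof.
move=> sA sB; apply/matrixP=> x y; rewrite !mxE coef_sum.
by apply: eq_bigr => l _; rewrite !mxE coefM_top.
Qed.

Lemma size_leM m n r i j (A : 'M[{poly k}]_(m, n)) (B : 'M_(n, r)) :
  size_le i A -> size_le j.+1 B -> size_le (i + j) (A *m B).
Proof.
move=> sA sB x y; rewrite mxE; apply: (leq_trans (size_sum _ _ _)).
apply/bigmax_leqP => l _; apply: (leq_trans (size_polyMleq _ _)).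
by rewrite -subn1 leq_subLR add1n -addnS leq_add.
Qed.

Lemma size_leD m n d (A B : 'M[{poly k}]_(m, n)) :
  size_le d A -> size_le d B -> size_le d (A + B).
Proof.
move=> sA sB i j; rewrite mxE.
by rewrite (leq_trans (size_polyD _ _)) // geq_max sA sB.
Qed.

Lemma size_leN m n d (A : 'M[{poly k}]_(m, n)) : size_le d A -> size_le d (- A).
Proof. by move=> sA i j; rewrite mxE size_polyN. Qed.

Lemma size_leXn m n d (c : 'M[k]_(m, n)) :
  size_le d.+1 ('X^d *: map_mx polyC c).
Proof.
move=> i j; rewrite !mxE mulrC mul_polyC.
by rewrite (leq_trans (size_scale_leq _ _)) ?size_polyXn.
Qed.

Lemma coefmxXn m n d (c : 'M[k]_(m, n)) :
  coefmx d ('X^d *: map_mx polyC c) = c.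
Proof. by apply/matrixP => i j; rewrite !mxE mulrC mul_polyC coefZ coefXn eqxx mulr1. Qed.

Lemma coefmxB m n d (A B : 'M[{poly k}]_(m, n)) :
  coefmx d (A - B) = coefmx d A - coefmx d B.
Proof. by apply/matrixP => i j; rewrite !mxE coefB. Qed.

(** Multiplication by [F] on coefficient arrays: row [i] of [r] lists the coefficients of a
    polynomial of degree less than [a]. The product is truncated below degree [e]. *)
Definition coefmul (n l a e : nat) (F : 'M[{poly k}]_(n, l)) (r : 'M[k]_(n, a)) :
  'M[k]_(l, e) := coefs_of_row e (row_of_coefs r *m F).

Lemma coefmul_is_linear n l a e (F : 'M[{poly k}]_(n, l)) :
  linear (@coefmul n l a e F).
Proof.
move=> c r s; rewrite /coefmul.
have -> : row_of_coefs (c *: r + s) = c%:P *: row_of_coefs r + row_of_coefs s.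
  by apply/rowP => i; rewrite !mxE !linearP mul_polyC.
rewrite mulmxDl -scalemxAl; apply/matrixP=> i j.
by rewrite mxE mxE coefD [in LHS]mxE coefCM !mxE.
Qed.

HB.instance Definition _ n l a e (F : 'M[{poly k}]_(n, l)) :=
  GRing.isLinear.Build k _ _ _ (@coefmul n l a e F) (@coefmul_is_linear n l a e F).

Variables (n l r a : nat) (F : 'M[{poly k}]_(n, l)).
Hypothesis size_F : size_le a.+1 F.
Hypothesis dims : (n * a = l * (a + a))%N.
Hypothesis free_F : row_free (lin_mx (@coefmul n l a (a + a) F)).

Lemma low_kernel_eq0 (u : 'rV[{poly k}]_n) :
  size_le a u -> u *m F = 0 -> u = 0.
Proof.
move=> su uF; have: mxvec (coefs_of_row a u) *m lin_mx (@coefmul n l a (a + a) F) = 0.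
  rewrite mul_vec_lin /= /coefmul coefs_of_rowK // uF.
  by apply/eqP; rewrite mxvec_eq0; apply/eqP/matrixP=> i j; rewrite !mxE coef0.
move/eqP; rewrite mulmx_free_eq0 // mxvec_eq0 => /eqP u0.
by rewrite -(coefs_of_rowK su) u0; apply/rowP => i; rewrite !mxE linear0 linear0.
Qed.

(** The system is square by [dims], so its injectivity makes it surjective. *)
Lemma low_image_full (G : 'rV[{poly k}]_l) :
  size_le (a + a) G -> exists2 u, size_le a u & u *m F = G.
Proof.
move=> sG; have full: row_full (lin_mx (@coefmul n l a (a + a) F)).
  by move: free_F; rewrite /row_free /row_full => /eqP ->; rewrite dims.
have /submxP[v Gv] := submx_full (mxvec (coefs_of_row (a + a) G)) full.
exists (row_of_coefs (vec_mx v : 'M_(n, a))); first exact: size_row_of_coefs.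
have: coefmul (a + a) F (vec_mx v : 'M_(n, a)) = coefs_of_row (a + a) G.
  by apply/(can_inj mxvecK); rewrite Gv -[v in RHS]vec_mxK mul_vec_lin.
move/(congr1 (@row_of_coefs _ _)); rewrite !coefs_of_rowK //.
exact: size_leM (size_row_of_coefs _) size_F.
Qed.

Variable W : 'M[k]_(r, n).
Hypothesis free_W : row_free W.
Hypothesis eq_W : (W :=: kermx (coefmx a F))%MS.

Lemma kernel_basis_exists :
  exists s : 'M[{poly k}]_(r, n),
    [/\ size_le a.+1 s, coefmx a s = W & s *m F = 0].
Proof.
have WF : W *m coefmx a F = 0 by apply/sub_kermxP; rewrite eq_W.
have rowE j : exists s : 'rV[{poly k}]_n,
    [/\ size_le a.+1 s, coefmx a s = row j W & s *m F = 0].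
  pose t := 'X^a *: map_mx polyC (row j W).
  have st : size_le a.+1 t by apply: size_leXn.
  (* The correction [u] exists because [t *m F], a priori of degree up to [2a], has top coefficient
     [row j W *m coefmx a F = 0]. *)
  have [u su uF] : exists2 u, size_le a u & u *m F = - (t *m F).
    apply/low_image_full/size_leN/size_le_coefmx; first by rewrite -addSn; apply: size_leM.
    by rewrite coefmxM_top // coefmxXn -row_mul WF row0.
  have su' : size_le a.+1 u by move=> x y; apply/leqW/su.
  exists (t + u); split; first exact: size_leD.
    rewrite -[u]opprK coefmxB coefmxXn [coefmx a (- u)](_ : _ = 0) ?subr0 //.
    by apply/matrixP=> x y; rewrite !mxE coefN nth_default ?oppr0.
  by rewrite mulmxDl uF addrN.
have [s sP] := fin_all_exists rowE; exists (\matrix_j s j); split.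
- by move=> i j; rewrite mxE; case: (sP i).
- apply/row_matrixP => i; case: (sP i) => _ <- _.
  by apply/rowP => j; rewrite !mxE.
- by apply/row_matrixP => i; rewrite row_mul rowK row0; case: (sP i).
Qed.

Variable s : 'M[{poly k}]_(r, n).
Hypothesis size_s : size_le a.+1 s.
Hypothesis top_s : coefmx a s = W.
Hypothesis ker_s : s *m F = 0.

(** Division by leading coefficients: the top coefficient of [T] is [c *m W], and subtracting
    [u *m s], with [u] equal to [c] times ['X^d], lowers the degree bound. At [d = 0] the remainder
    vanishes by [low_kernel_eq0]. *)
Lemma kernel_basis_span d (T : 'rV[{poly k}]_n) :
  size_le (d + a) T -> T *m F = 0 -> exists2 u, size_le d u & T = u *m s.
Proof.
elim: d T => [|d IH] T sT TF.
  exists 0; first by move=> i j; rewrite mxE size_poly0.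
  by rewrite mul0mx; apply: low_kernel_eq0.
have /submxP[c cW] : (coefmx (d + a) T <= W)%MS.
  by rewrite eq_W; apply/sub_kermxP; rewrite -coefmxM_top // TF;
    apply/matrixP=> i j; rewrite !mxE coef0.
pose u := 'X^d *: map_mx polyC c.
have su : size_le d.+1 u by apply: size_leXn.
have [||v sv Tv] := IH (T - u *m s).
- apply: size_le_coefmx; last by rewrite coefmxB coefmxM_top // coefmxXn top_s cW subrr.
  by apply/size_leD/size_leN => //; rewrite -addSn; apply: size_leM.
- by rewrite mulmxBl TF -mulmxA ker_s mulmx0 subrr.
exists (v + u); first by apply: size_leD => // i j; apply/leqW/sv.
by rewrite mulmxDl -Tv subrK.
Qed.

Lemma kernel_basis_free d (u : 'rV[{poly k}]_r) :
  size_le d u -> u *m s = 0 -> u = 0.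
Proof.
elim: d => [|d IH] su us.
  by apply/matrixP=> i j; have := su i j; rewrite leqn0 size_poly_eq0 mxE => /eqP.
apply: IH => //; apply: size_le_coefmx => //.
have: coefmx d u *m W = 0.
  by rewrite -top_s -coefmxM_top // us; apply/matrixP=> i j; rewrite !mxE coef0.
by move/eqP; rewrite mulmx_free_eq0 // => /eqP.
Qed.

End PolynomialMatrices.

(** * Bihomogeneous polynomials and their dehomogenizations *)

Section Dehomogenization.

Variable k : fieldType.
Implicit Types (p : coxring k) (G : {poly {poly k}}).

Definition vu : coxring k := 'X_(inord 2).
Definition vv : coxring k := 'X_(inord 3).

Definition dehom_var (i : 'I_4) : {poly {poly k}} :=
  nth 0 [:: 'X%:P; 1; 'X; 1] i.

(* The substitution s = x, t = 1, u = y, v = 1 into k[x][y]. *)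
Definition dehom : coxring k -> {poly {poly k}} :=
  mmap (polyC \o polyC) dehom_var.

HB.instance Definition _ := GRing.RMorphism.on dehom.

(** The outer index [l] is the exponent of u and the inner index [i] that of s; the exponents of v
    and t complete the bidegree. *)
Definition homogenize (d : nat * nat) (G : {poly {poly k}}) : coxring k :=
  \sum_(l < d.2.+1) \sum_(i < d.1.+1)
    G`_l`_i *: (vs ^+ i * vt ^+ (d.1 - i) * (vu ^+ l * vv ^+ (d.2 - l))).

Lemma ord4_ind (P : 'I_4 -> Prop) :
  P (inord 0) -> P (inord 1) -> P (inord 2) -> P (inord 3) -> forall i, P i.
Proof.
move=> P0 P1 P2 P3 i; rewrite -(inord_val i).
by case: i => -[|[|[|[|]]]].
Qed.

Lemma dehom_var_mon (m : 'X_{1..4}) :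
  mmap1 dehom_var m = ('X^(m (inord 0)))%:P * 'X^(m (inord 2)).
Proof.
have E (i : 'I_4) j (lt : (j < 4)%N) : i = j :> nat -> i = inord j.
  by move=> e; apply/val_inj;
    rewrite /= inordK.
rewrite /mmap1 !big_ord_recl big_ord0 /dehom_var /= !expr1n !mul1r mulr1 rmorphXn /=.
by congr (_ ^+ m _ * _ ^+ m _); apply: E.
Qed.

Lemma dehomE p l i :
  (dehom p)`_l`_i =
  \sum_(m <- msupp p) p@_m * ((m (inord 0) == i) && (m (inord 2) == l))%:R.
Proof.
rewrite /dehom /mmap !coef_sum; apply: eq_bigr => m _.
rewrite dehom_var_mon /= !coefCM coefXn mulr_natr.
rewrite [l == _]eq_sym; case: (m _ == l); rewrite ?andbF ?andbT ?mulr0n ?coef0 //.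
by rewrite mulr1n coefXn eq_sym.
Qed.

Lemma bihomogP d p :
  bihomog d p <-> forall m : 'X_{1..4}, p@_m != 0 ->
    (m (inord 0) + m (inord 1) = d.1)%N /\ (m (inord 2) + m (inord 3) = d.2)%N.
Proof. by split=> h m; have := h m; rewrite mcoeff_msupp. Qed.

(** In a fixed bidegree the exponents of s and u determine those of t and v, so only one monomial of
    [p] contributes to each coefficient of [dehom p]. *)
Lemma bihomog_coef d p (m : 'X_{1..4}) : bihomog d p ->
  (m (inord 0) + m (inord 1) = d.1)%N -> (m (inord 2) + m (inord 3) = d.2)%N ->
  p@_m = (dehom p)`_(m (inord 2))`_(m (inord 0)).
Proof.
move=> hp e1 e2; rewrite dehomE.
have z m' : m' \in msupp p -> m' != m ->
    p@_m' * ((m' (inord 0) == m (inord 0)) && (m' (inord 2) == m (inord 2)))%:R = 0.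
  move=> /hp[e3 e4] ne; case: andP => [[/eqP e5 /eqP e6]|]; last by rewrite mulr0.
  case/eqP: ne; apply/mnmP; apply: ord4_ind => //.
    by apply/eqP; rewrite -(eqn_add2l (m (inord 0))) e1 -e3 e5.
  by apply/eqP; rewrite -(eqn_add2l (m (inord 2))) e2 -e4 e6.
have [ms|ms] := boolP (m \in msupp p).
  rewrite (bigD1_seq m) //= !eqxx mulr1 big_seq_cond big1 ?addr0 // => m' /andP[].
  exact: z.
rewrite memN_msupp_eq0 // big_seq big1 // => m' sm'; apply: z => //.
by apply: contraNneq ms => <-.
Qed.

Lemma dehom_inj d p p' :
  bihomog d p -> bihomog d p' -> dehom p = dehom p' -> p = p'.
Proof.
move=> hp hp' e; apply/mpolyP => m.
have [e0|/(proj1 (bihomogP _ _) hp)[e1 e2]] := eqVneq p@_m 0.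
  have [-> //|/(proj1 (bihomogP _ _) hp')[e1 e2]] := eqVneq p'@_m 0.
  by rewrite (bihomog_coef hp) // (bihomog_coef hp') // e.
by rewrite (bihomog_coef hp) // (bihomog_coef hp') // e.
Qed.

Lemma size_dehom d p : bihomog d p -> (size (dehom p) <= d.2.+1)%N.
Proof.
move=> hp; apply/leq_sizeP => l lt; apply/polyP => i; rewrite dehomE coef0.
rewrite big_seq big1 // => m /hp[_ e2]; case: andP => [[_ /eqP e]|]; last by rewrite mulr0.
by move: lt; rewrite -e2 e ltnNge leq_addr.
Qed.

Lemma size_dehom_coef d p l : bihomog d p -> (size (((dehom p)`_l)%R) <= d.1.+1)%N.
Proof.
move=> hp; apply/leq_sizeP => i lt; rewrite dehomE.
rewrite big_seq big1 // => m /hp[e2 _]; case: andP => [[/eqP e _]|]; last by rewrite mulr0.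
by move: lt; rewrite -e2 e ltnNge leq_addr.
Qed.

Lemma bihomog0 d : bihomog d (0 : coxring k).
Proof. by move=> m; rewrite msupp0. Qed.

Lemma bihomogD d p p' : bihomog d p -> bihomog d p' -> bihomog d (p + p').
Proof. by move=> h h' m /msuppD_le; rewrite mem_cat => /orP[/h|/h']. Qed.

Lemma bihomogZ d c p : bihomog d p -> bihomog d (c *: p).
Proof. by move=> h m /msuppZ_le /h. Qed.

Lemma bihomog_sum (I : Type) (r : seq I) d (P : pred I) (f : I -> coxring k) :
  (forall i, P i -> bihomog d (f i)) -> bihomog d (\sum_(i <- r | P i) f i).
Proof.
by move=> h; apply: (big_ind (bihomog d)) => //; [exact: bihomog0|exact: bihomogD].
Qed.

Lemma bihomogM d d' p p' : bihomog d p -> bihomog d' p' ->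
  bihomog (d.1 + d'.1, d.2 + d'.2)%N (p * p').
Proof.
move=> h h' m /msuppM_le /allpairsP[[m1 m2] /= [/h[e1 e2] /h'[e3 e4] ->]].
by rewrite !mnmDE -e1 -e2 -e3 -e4 addnACA; split => //; rewrite addnACA.
Qed.

Lemma bihomog_mon a b c d :
  bihomog (a + b, c + d)%N (vs ^+ a * vt ^+ b * (vu ^+ c * vv ^+ d) : coxring k).
Proof.
rewrite /vs /vt /vu /vv !mpolyXn -!mpolyXD => m; rewrite msuppX inE => /eqP ->.
by rewrite !(mnmDE, mulmnE, mnm1E) -!val_eqE /= !inordK //= !(mul1n, mul0n, addn0, add0n).
Qed.

Lemma dehom_mon a b c d :
  dehom (vs ^+ a * vt ^+ b * (vu ^+ c * vv ^+ d)) = ('X^a)%:P * 'X^c.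
Proof.
have dehomX i : dehom 'X_i = dehom_var i by rewrite /dehom mmapX mmap1U.
rewrite !rmorphM !rmorphXn /vs /vt /vu /vv /= !dehomX /dehom_var.
by rewrite !inordK //= !expr1n !mulr1.
Qed.

Lemma bihomog_homogenize d G : bihomog d (homogenize d G).
Proof.
apply: bihomog_sum => l _; apply: bihomog_sum => i _; apply: bihomogZ.
have := @bihomog_mon i (d.1 - i) l (d.2 - l); case: d l i => a b /= l i.
by rewrite !subnKC ?leq_ord.
Qed.

Lemma dehomZ c p : dehom (c *: p) = c%:P%:P * dehom p.
Proof.
have dehomC : dehom c%:MP = c%:P%:P by rewrite /dehom mmapC.
by rewrite -mul_mpolyC rmorphM /= dehomC.
Qed.

Lemma homogenizeK d G :
  (size G <= d.2.+1)%N -> (forall l, (size ((G`_l)%R) <= d.1.+1)%N) ->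
  dehom (homogenize d G) = G.
Proof.
move=> sG sGl; rewrite rmorph_sum /=.
rewrite -[RHS]coefK poly_def (big_ord_widen _ (fun i => G`_i *: 'X^i) sG) [RHS]big_mkcond.
apply: eq_bigr => l _; rewrite rmorph_sum /=.
transitivity (G`_l *: 'X^l); last first.
  by case: ltnP => // h; rewrite nth_default // scale0r.
under eq_bigr => i _ do rewrite dehomZ dehom_mon mulrA -polyCM mul_polyC -!mul_polyC.
rewrite -mulr_suml -mul_polyC; congr (_ * _); rewrite -rmorph_sum; congr polyC.
rewrite -[RHS]coefK poly_def (big_ord_widen _ (fun i => G`_l`_i *: 'X^i) (sGl l)).
rewrite [RHS]big_mkcond.
apply: eq_bigr => i _; rewrite mul_polyC.
by case: ltnP => // h; rewrite nth_default // scale0r.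
Qed.

Lemma dehomK d p : bihomog d p -> homogenize d (dehom p) = p.
Proof.
move=> hp; apply: (dehom_inj _ hp); first exact: bihomog_homogenize.
by rewrite homogenizeK // => [|l]; [exact: size_dehom|exact: size_dehom_coef].
Qed.

End Dehomogenization.

(** * Syzygies of bidegree (d,0) as rows of polynomials in x *)

Section Slices.

Variable k : fieldType.
Implicit Types (f : 'cV[coxring k]_4) (v : 'rV[coxring k]_4).

(* Column l holds the coefficients of u^l v^(1-l). *)
Definition dehom_forms f : 'M[{poly k}]_(4, 2) :=
  \matrix_(i, l) (dehom (f i 0))`_l.

Lemma dehom_formsE f i l : dehom_forms f i l = (dehom (f i 0))`_l.
Proof. by rewrite mxE. Qed.

Definition dehom_row v : 'rV[{poly k}]_4 := map_mx (fun p => (dehom p)`_0) v.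

Definition homogenize_row d (u : 'rV[{poly k}]_4) : 'rV[coxring k]_4 :=
  map_mx (fun p => homogenize (d, 0)%N p%:P) u.

Lemma size_dehom_forms a f : (forall i, bihomog (a, 1)%N (f i 0)) ->
  size_le a.+1 (dehom_forms f).
Proof. by move=> hf i l; rewrite mxE; apply: size_dehom_coef (hf i). Qed.

Lemma dehom_rowE d v i : bihomog (d, 0)%N (v 0 i) ->
  dehom (v 0 i) = (dehom_row v 0 i)%:P.
Proof. by move=> /size_dehom /size1_polyC; rewrite mxE. Qed.

Lemma size_dehom_row d v : (forall i, bihomog (d, 0)%N (v 0 i)) ->
  size_le d.+1 (dehom_row v).
Proof. by move=> hv i j; rewrite mxE (ord1 i); apply: size_dehom_coef (hv j). Qed.

Lemma bihomog_row d u i : bihomog (d, 0)%N (homogenize_row d u 0 i).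
Proof. by rewrite mxE; apply: bihomog_homogenize. Qed.

Lemma homogenize_rowK d u : size_le d.+1 u -> dehom_row (homogenize_row d u) = u.
Proof.
move=> su; apply/rowP=> i; rewrite !mxE homogenizeK ?coefC //=; first exact: size_polyC_leq1.
by move=> l; rewrite coefC; case: (l == 0%N); rewrite ?size_poly0.
Qed.

(** The dehomogenized entries of [v] do not involve y, so the coefficient of y^l in the
    dehomogenized sum is [dehom_row v] times column [l] of [dehom_forms f]. For [l] at least 2 it
    vanishes, the forms having degree at most 1 in y. *)
Lemma syzygy_dehom a d f v :
  (forall i, bihomog (a, 1)%N (f i 0)) -> (forall i, bihomog (d, 0)%N (v 0 i)) ->
  v *m f = 0 <-> dehom_row v *m dehom_forms f = 0.
Proof.
move=> hf hv.
have E l : (dehom ((v *m f) 0 0))`_l =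
    \sum_i dehom_row v 0 i * (dehom (f i 0))`_l.
  rewrite mxE rmorph_sum coef_sum; apply: eq_bigr => i _.
  by rewrite rmorphM /= (dehom_rowE (hv i)) coefCM.
have E' l : (dehom_row v *m dehom_forms f) 0 l = (dehom ((v *m f) 0 0))`_l.
  by rewrite E mxE; apply: eq_bigr => i _; rewrite [dehom_forms _ _ _]mxE.
split=> [vf|vF].
  by apply/rowP=> l; rewrite E' vf !mxE rmorph0 coef0.
apply/matrixP=> i j; rewrite !ord1 [RHS]mxE.
apply: (@dehom_inj _ (d + a, 0 + 1)%N); [|exact: bihomog0|].
  by rewrite mxE; apply: bihomog_sum => x _; apply: (bihomogM (hv x) (hf x)).
rewrite rmorph0; apply/polyP => l; rewrite coef0.
have [l2|l2] := ltnP l 2.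
  by rewrite -(E' (Ordinal l2)) vF mxE.
by rewrite E big1 // => x _; rewrite [X in _ * X]nth_default ?mulr0 //
  (leq_trans (size_dehom (hf x))).
Qed.

(** A nonzero relation [w] between the two columns would give a base point with t = 0: at (s,t) =
    (1,0), (u,v) = (w_1,w_0) each form takes as value an entry of this relation, that is, 0. *)
Lemma bpf_leading_rank a f :
  (forall i, bihomog (a, 1)%N (f i 0)) -> basepoint_free f ->
  \rank (coefmx a (dehom_forms f)) = 2.
Proof.
move=> hf bpf; rewrite -mxrank_tr; apply/eqP; rewrite -/(row_free _).
apply: inj_row_free => w w0; apply/eqP; apply: contraT => wn0.
pose x (i : 'I_4) := nth 0 [:: 1; 0; w 0 1; w 0 0] i : k.
have [||i] := bpf x.
- by left; rewrite /x inordK //=; exact: oner_neq0.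
- rewrite /x !inordK //=; apply/orP; apply: contraNT wn0.
  rewrite negb_or !negbK => /andP[/eqP w1 /eqP w2]; apply/eqP/rowP => l.
  by rewrite mxE; case: l => -[|[|//]] lt;
    [rewrite -[RHS]w2|rewrite -[RHS]w1]; congr (w _ _); apply/val_inj.
have := congr1 (fun v : 'rV[k]_4 => v 0 i) w0; rewrite !mxE big_ord_recl big_ord1 !mxE => e.
rewrite -(dehomK (hf i)) /homogenize raddf_sum /= big_ord_recl big_ord1 !raddf_sum /=.
rewrite !big_ord_recr /= !big1; first last.
  1,2: move=> j _; rewrite mevalZ !mevalM !rmorphXn /= !mevalXU /x !inordK //=;
    by rewrite expr0n subn_eq0 leqNgt ltn_ord !(mulr0, mul0r).
rewrite !add0r !mevalZ !mevalM !rmorphXn /= !mevalXU /x !inordK //=.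
rewrite subnn !expr1n !expr0 !expr1 !mul1r mulr1.
rewrite mulrC [_ * w 0 1]mulrC.
apply: contraTT => _; rewrite negbK -[eqbRHS]e; apply/eqP.
by congr (w _ _ * _ + w _ _ * _); apply/val_inj.
Qed.

End Slices.

(** * Extension of scalars to the coordinate ring of P^3 *)

Section Lifting.

Variables (k : fieldType) (n p : nat) (V : 'rV[coxring k]_4 -> Prop).
Variable e : 'I_n -> 'I_p -> 'rV[coxring k]_4.
Hypothesis basis_e : forall v, V v ->
  exists! c : 'M[k]_(n, p), v = \sum_j \sum_i (c j i)%:MP *: e j i.

Lemma coef_Sinj_comb (c : 'M[p3ring k]_(n, p)) m :
  map_mx (mcoeff m)
    (\sum_j \sum_i Sinj (c j i) *: map_mx (@mpolyC 4 (coxring k)) (e j i)) =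
  \sum_j \sum_i ((c j i)@_m)%:MP *: e j i.
Proof.
apply/rowP=> l; rewrite mxE !summxE raddf_sum; apply: eq_bigr => j _.
rewrite !summxE raddf_sum; apply: eq_bigr => i _.
by rewrite !mxE [Sinj _ * _]mulrC /= mcoeffCM mcoeff_map_mpoly mulrC.
Qed.

(** Unique expansions over k give unique expansions over S: [T] is expanded separately at each
    monomial in X, Y, Z, W. *)
Lemma lift_basis (T : 'rV[RS k]_4) : (forall m, V (map_mx (mcoeff m) T)) ->
  exists! c : 'M[p3ring k]_(n, p),
    T = \sum_j \sum_i Sinj (c j i) *: map_mx (@mpolyC 4 (coxring k)) (e j i).
Proof.
move=> VT; have coef_inj (T1 T2 : 'rV[RS k]_4) :
    (forall m, map_mx (mcoeff m) T1 = map_mx (mcoeff m) T2) -> T1 = T2.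
  move=> eT; apply/rowP=> l; apply/mpolyP=> m.
  by have /rowP/(_ l) := eT m; rewrite !mxE.
pose E m (c : 'M[k]_(n, p)) := map_mx (mcoeff m) T == \sum_j \sum_i (c j i)%:MP *: e j i.
have exE m : exists c, E m c by have [c [/eqP]] := basis_e (VT m); exists c.
(* [N] exceeds the degree of every monomial of [T]. Cutting the chosen coefficients off at [N] makes
   the entries of [c] polynomials and loses nothing. *)
pose N := (\max_(l < 4) msize (T 0%R l))%N.
pose c : 'M[p3ring k]_(n, p) :=
  \matrix_(j, i) \sum_(m : 'X_{1..4 < N}) xchoose (exE m) j i *: 'X_[m].
have Tc : T = \sum_j \sum_i Sinj (c j i) *: map_mx (@mpolyC 4 (coxring k)) (e j i).
  apply: coef_inj => m; rewrite coef_Sinj_comb.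
  have [ltmN|leNm] := ltnP (mdeg m) N.
    rewrite (eqP (xchooseP (exE m))); apply: eq_bigr => j _; apply: eq_bigr => i _.
    by rewrite mxE (mcoeff_mpoly (fun m => xchoose (exE m) j i)).
  rewrite big1 => [|j _].
    apply/rowP=> l; rewrite !mxE memN_msupp_eq0 // msize_mdeg_ge //.
    by apply: leq_trans leNm; apply: (leq_bigmax l).
  rewrite big1 // => i _; rewrite mxE raddf_sum big1 ?mpolyC0 ?scale0r //.
  move=> m' _; rewrite /= mcoeffZ mcoeffX; case: eqP => [e'|]; last by rewrite mulr0.
  by move: leNm; rewrite -e' leqNgt bmdeg.
exists c; split=> // c' Tc'; apply/matrixP=> j i; apply/mpolyP=> m.
have [c0 [_ c0U]] := basis_e (VT m).
transitivity (c0 j i).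
  by rewrite (c0U (map_mx (mcoeff m) c)) ?mxE // {1}Tc coef_Sinj_comb;
    do 2!apply: eq_bigr => ? _; rewrite [map_mx _ c _ _]mxE.
by rewrite (c0U (map_mx (mcoeff m) c')) ?mxE // {1}Tc' coef_Sinj_comb;
  do 2!apply: eq_bigr => ? _; rewrite [map_mx _ c' _ _]mxE.
Qed.

End Lifting.

(** * The generic square system in degree a-1 *)

Section GenericForms.

Variables (k : fieldType) (a q : nat) (b : 'cV[coxring k]_q).

Lemma combineE (C : 'M[k]_(4, q)) i :
  combine C b i 0 = \sum_j C i j *: b j 0.
Proof. by rewrite mxE; apply: eq_bigr => j _; rewrite mxE mul_mpolyC. Qed.

Lemma dehom_forms_combine (C : 'M[k]_(4, q)) :
  dehom_forms (combine C b) = map_mx polyC C *m \matrix_(j, l) (dehom (b j 0))`_l.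
Proof.
apply/matrixP=> i l; rewrite dehom_formsE combineE rmorph_sum coef_sum [RHS]mxE.
by apply: eq_bigr => j _; rewrite /= dehomZ coefCM !mxE.
Qed.

(* The matrix of the map R_(a-1,0)^4 -> R_(2a-1,1), (s_i) |-> sum s_i f_i. *)
Definition syzygy_mx (C : 'M[k]_(4, q)) : 'M[k]_(4 * a, 2 * (a + a)) :=
  lin_mx (@coefmul k 4 2 a (a + a) (dehom_forms (combine C b))).

(** Linearity in [C] is what [generic_row_free] asks for; it holds because
    [dehom_forms (combine C b)] is [C] times a fixed matrix. *)
Lemma syzygy_mx_is_linear : linear syzygy_mx.
Proof.
move=> c A B; rewrite /syzygy_mx !dehom_forms_combine; set D := \matrix_(_, _) _.
have -> : map_mx polyC (c *: A + B) = c%:P *: map_mx polyC A + map_mx polyC B.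
  by apply/matrixP=> i j; rewrite !mxE polyCD polyCM.
rewrite mulmxDl -scalemxAl; move: (_ *m D) (_ *m D) => {D} FB FA.
have coefmulD r : coefmul (a + a) (c%:P *: FA + FB) r =
    c *: @coefmul k 4 2 a (a + a) FA r + coefmul (a + a) FB r.
  rewrite /coefmul mulmxDr -scalemxAr; apply/matrixP=> i j.
  by rewrite mxE mxE coefD [in LHS]mxE coefCM !mxE.
have linE f i j : lin_mx f i j = mxvec (f (vec_mx (delta_mx 0 i))) 0 j :> k.
  by rewrite [LHS]mxE.
apply/matrixP=> i j; rewrite [RHS]mxE [X in _ = X + _]mxE !linE.
by rewrite coefmulD linearP [LHS]mxE [X in X + _ = _]mxE.
Qed.

HB.instance Definition _ :=
  GRing.isLinear.Build k _ _ _ syzygy_mx syzygy_mx_is_linear.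

Hypothesis basis_b : bigraded_basis (a, 1%N) b.

Lemma bihomog_combine (C : 'M[k]_(4, q)) i : bihomog (a, 1)%N (combine C b i 0).
Proof.
by rewrite combineE; apply: bihomog_sum => j _; apply/bihomogZ/(proj1 basis_b).
Qed.

(* Witness: the forms s^a u, t^a u, s^a v, t^a v. *)
Lemma syzygy_mx_free_witness : exists C, row_free (syzygy_mx C).
Proof.
(* For i = 0, 1, 2, 3 these exponents give s^a u, t^a u, s^a v, t^a v. *)
pose e1 (i : 'I_4) := if odd i then 0%N else a; pose e2 (i : 'I_4) := (i < 2 : nat)%N.
pose f i := vs ^+ e1 i * vt ^+ (a - e1 i) * (vu k ^+ e2 i * vv k ^+ (1 - e2 i)).
have hf i : bihomog (a, 1)%N (f i).
  have := @bihomog_mon k (e1 i) (a - e1 i) (e2 i) (1 - e2 i).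
  by rewrite !subnKC //; [rewrite /e2; case: (_ < _)%N|rewrite /e1; case: odd].
have fE i : exists c : 'rV[k]_q, f i = \sum_j c 0 j *: b j 0.
  by have [c [fc _]] := proj2 basis_b _ (hf i); exists c.
have [c cE] := fin_all_exists fE; exists (\matrix_i c i).
have combE i : combine (\matrix_i c i) b i 0 = f i.
  by rewrite combineE cE; apply: eq_bigr => j _; rewrite mxE.
set F := dehom_forms (combine (\matrix_i c i) b).
have FE i (l : 'I_2) : F i l = 'X^(e1 i) * (e2 i == l)%:R.
  rewrite mxE combE dehom_mon coefCM coefXn eq_sym.
  by case: (e2 i == l); rewrite ?mulr1n ?mulr0n.
have sF : size_le a.+1 F by apply: size_dehom_forms => i; rewrite combE; apply: hf.
apply: inj_row_free => v v0; pose r : 'M[k]_(4, a) := vec_mx v.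
suff r0 : row_of_coefs r = 0.
  apply: (can_inj (@vec_mxK _ 4 a)); rewrite -/r linear0 -(row_of_coefsK r) r0.
  by apply/matrixP=> i j; rewrite !mxE coef0.
have uF : row_of_coefs r *m F = 0.
  have su : size_le (a + a) (row_of_coefs r *m F).
    by apply: size_leM sF; apply: size_row_of_coefs.
  rewrite -(coefs_of_rowK su) -/(coefmul (a + a) F r).
  have -> : coefmul (a + a) F r = 0.
    by apply: (can_inj mxvecK); rewrite -mul_vec_lin /r vec_mxK [LHS]v0 linear0.
  by apply/rowP=> i; rewrite !mxE !linear0.
have su := size_row_of_coefs r; move: (row_of_coefs r) uF su => u uF su.
have {uF} u0 l := congr1 (fun w : 'rV_2 => w 0 l) uF.
(* The two columns decouple: [l = 1] gives u_0 x^a + u_1 = 0 and [l = 0] gives u_2 x^a + u_3 = 0,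
   where all u_i have degree less than [a]. *)
have sumE (l : 'I_2) :
    u 0 (inord 0) * ('X^a * (1%N == l)%:R) + u 0 (inord 1) * (1%N == l)%:R +
    u 0 (inord 2) * ('X^a * (0%N == l)%:R) + u 0 (inord 3) * (0%N == l)%:R = 0.
  have := u0 l; rewrite /= mxE [RHS]mxE => <-.
  rewrite !big_ord_recl big_ord0 addr0 !FE /e1 /e2 /= !expr0 !mul1r !addrA.
  by congr (u 0 _ * _ + u 0 _ * _ + u 0 _ * _ + u 0 _ * _); apply/val_inj;
    rewrite /= inordK.
have [u0E u1E] : u 0 (inord 0) = 0 /\ u 0 (inord 1) = 0.
  by apply: Xn_combination_eq0 => //; have := sumE 1; rewrite /= !mulr1 !mulr0 !addr0.
have [u2E u3E] : u 0 (inord 2) = 0 /\ u 0 (inord 3) = 0.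
  by apply: Xn_combination_eq0 => //; have := sumE 0; rewrite /= !mulr1 !mulr0 !add0r.
by apply/rowP; apply: ord4_ind; rewrite mxE.
Qed.

End GenericForms.

(** * The two syzygies *)

Section SliceBasis.

Variables (k : fieldType) (a : nat) (f : 'cV[coxring k]_4) (s : 'M[{poly k}]_(2, 4)).
Hypothesis a_gt0 : (0 < a)%N.
Hypothesis bihomog_f : forall i, bihomog (a, 1)%N (f i 0).
Hypothesis size_s : size_le a.+1 s.
Hypothesis ker_s : s *m dehom_forms f = 0.
Hypothesis span_s : forall T : 'rV_4, size_le (a + a) T -> T *m dehom_forms f = 0 ->
  exists2 u, size_le a u & T = u *m s.
Hypothesis free_s : forall u : 'rV_2, size_le a u -> u *m s = 0 -> u = 0.

Definition kernel_syzygy (j : 'I_2) : 'rV[coxring k]_4 := homogenize_row a (row j s).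

Lemma size_row_kernel j : size_le a.+1 (row j s).
Proof. by move=> x y; rewrite mxE. Qed.

Lemma kernel_syzygyP j : syzygy f (a, 0)%N (kernel_syzygy j).
Proof.
have hs i : bihomog (a, 0)%N (kernel_syzygy j 0 i) by apply: bihomog_row.
split=> //; apply/(syzygy_dehom bihomog_f hs).
rewrite homogenize_rowK; last exact: size_row_kernel.
by rewrite -row_mul ker_s row0.
Qed.

Definition syzygy_comb (c : 'M[k]_(2, a)) : 'rV[coxring k]_4 :=
  \sum_j \sum_i (c j i)%:MP *: ((vs ^+ i * vt ^+ (a.-1 - i)) *: kernel_syzygy j).

Lemma bihomog_multiple (i : 'I_a) (p : coxring k) :
  bihomog (a, 0)%N p -> bihomog (2 * a - 1, 0)%N ((vs ^+ i * vt ^+ (a.-1 - i)) * p).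
Proof.
move=> hp; have := @bihomog_mon k i (a.-1 - i) 0 0.
rewrite !expr0 !mulr1 subnKC => [hm|]; last by rewrite -ltnS prednK // ltn_ord.
have := bihomogM hm hp; congr (bihomog (_, _) _).
by case: (a) a_gt0 => // n _; rewrite mul2n -addnn subn1.
Qed.

Lemma bihomog_comb c l : bihomog (2 * a - 1, 0)%N (syzygy_comb c 0 l).
Proof.
rewrite summxE; apply: bihomog_sum => j _; rewrite summxE; apply: bihomog_sum => i _.
by rewrite mxE mul_mpolyC mxE; apply/bihomogZ/bihomog_multiple/bihomog_row.
Qed.

(** The monomial s^i t^(a-1-i) dehomogenizes to x^i, so row [j] of [c] lists the coefficients of the
    polynomial multiplying row [j] of the matrix [s]. *)
Lemma dehom_row_comb c : dehom_row (syzygy_comb c) = row_of_coefs c *m s.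
Proof.
apply/rowP=> l; rewrite mxE summxE rmorph_sum coef_sum [RHS]mxE.
apply: eq_bigr => j _; rewrite summxE rmorph_sum coef_sum [row_of_coefs _ _ _]mxE.
rewrite rVpoly_sum mulr_suml; apply: eq_bigr => i _.
rewrite mxE mul_mpolyC /= dehomZ mxE coefCM rmorphM /=.
have := @dehom_mon k i (a.-1 - i) 0 0; rewrite !expr0 !mulr1 => ->.
rewrite coefCM (dehom_rowE (@bihomog_row k a (row j s) l)) coefC /=.
rewrite homogenize_rowK; last exact: size_row_kernel.
by rewrite !mxE mul_polyC scalerAl.
Qed.

Lemma slice_basis v : syzygy f (2 * a - 1, 0)%N v -> exists! c, v = syzygy_comb c.
Proof.
(* Degree [2a-1] means size at most [a + a], which leaves multipliers of size at most [a]: the span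
   of the x^i with [i < a]. *)
have da : (2 * a - 1).+1 = (a + a)%N.
  by rewrite subn1 prednK ?muln_gt0 ?a_gt0 // mul2n addnn.
move=> [hv /(syzygy_dehom bihomog_f hv) vF].
have [|u su vE] := span_s _ vF; first by rewrite -da; apply: size_dehom_row.
exists (coefs_of_row a u); split=> [|c vc].
  apply/rowP=> l; apply: (@dehom_inj _ (2 * a - 1, 0)%N); [exact: hv|exact: bihomog_comb|].
  rewrite (dehom_rowE (hv l)) (dehom_rowE (@bihomog_comb _ l)) dehom_row_comb.
  by rewrite coefs_of_rowK // vE.
apply: (can_inj (@row_of_coefsK k 2 a)); rewrite coefs_of_rowK //.
apply/eqP; rewrite -subr_eq0; apply/eqP/free_s.
  by apply/size_leD/size_leN => //; apply: size_row_of_coefs.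
by rewrite mulmxBl -vE -dehom_row_comb vc subrr.
Qed.

Lemma syzygy_multiple j (i : 'I_a) :
  syzygy f (2 * a - 1, 0)%N ((vs ^+ i * vt ^+ (a.-1 - i)) *: kernel_syzygy j).
Proof.
split=> [l|]; first by rewrite mxE; apply/bihomog_multiple/bihomog_row.
by rewrite -scalemxAl (proj2 (kernel_syzygyP j)) scaler0.
Qed.

Lemma kernel_syzygies_determine :
  first_map_determined_by f a kernel_syzygy.
Proof.
split; first split.
- move=> j i m; rewrite /syz_multiple.
  (* The multiples are constant in X, Y, Z, W: only the coefficient at [m = 0] can be nonzero. *)
  have -> : map_mx (mcoeff m) (map_mx (@mpolyC 4 (coxring k))
        ((vs ^+ i * vt ^+ (a.-1 - i)) *: kernel_syzygy j)) =
      (m == 0%MM)%:R *: ((vs ^+ i * vt ^+ (a.-1 - i)) *: kernel_syzygy j).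
    by apply/rowP=> l; rewrite [LHS]mxE [X in mcoeff m X]mxE /= mcoeffC [RHS]mxE mulrC.
  case: (m == _); first by rewrite scale1r; apply: syzygy_multiple.
  by rewrite scale0r; split=> [l|]; [rewrite mxE; apply: bihomog0|rewrite mul0mx].
- by move=> T /(lift_basis slice_basis).
move=> j i; have E : first_map (syz_multiple (kernel_syzygy j) i) =
    (vs ^+ i * vt ^+ (a.-1 - i)) *: \sum_(l < 4) kernel_syzygy j 0 l *: 'X_l.
  rewrite /first_map scaler_sumr; apply: eq_bigr => l _.
  by rewrite mxE mul_mpolyC mxE scalerA.
split=> // m; rewrite E mcoeffZ raddf_sum; apply: bihomog_multiple.
apply: bihomog_sum => l _; rewrite /= mcoeffZ mcoeffX mulr_natr.
case: (_ == m); rewrite ?mulr0n ?mulr1n; [exact: bihomog_row|exact: bihomog0].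
Qed.

End SliceBasis.

(** * Generic forms: the degenerate case a = 0 and the conclusion *)

Lemma kernel_row_basis (k : fieldType) (m n r : nat) (A : 'M[k]_(m, n)) :
  (m - \rank A)%N = r -> exists2 W : 'M_(r, m), row_free W & (W :=: kermx A)%MS.
Proof.
move=> <-; rewrite -mxrank_ker.
by exists (row_base (kermx A)); [exact: row_base_free|exact: eq_row_base].
Qed.

(** A syzygy with constant entries is a linear relation over k between the forms. *)
Lemma constant_syzygies (k : fieldType) (f : 'cV[coxring k]_4)
    (v : 'rV[coxring k]_4) :
  lin_indep f -> syzygy f (0, 0)%N v -> v = 0.
Proof.
move=> indep [hv vf].
have vC i : v 0 i = ((v 0 i)@_0%MM)%:MP.
  apply/mpolyP=> m; rewrite mcoeffC.
  have [-> |m0] := eqVneq m 0%MM; first by rewrite mulr1.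
  rewrite mulr0; apply/eqP; apply: contraNT m0 => /(proj1 (bihomogP _ _) (hv i))[e1 e2].
  apply/eqP/mnmP; apply: ord4_ind; rewrite mnm0E; apply/eqP.
  1,2: by move/eqP: e1; rewrite addn_eq0 => /andP[].
  1,2: by move/eqP: e2; rewrite addn_eq0 => /andP[].
have c0 : map_mx (mcoeff 0%MM) v = 0.
  apply: indep; have : (v *m f) 0 0 = 0 by rewrite vf mxE.
  rewrite mxE => vf0; apply: etrans vf0.
  by apply: eq_bigr => i _; rewrite mxE [in RHS]vC mul_mpolyC.
by apply/rowP=> i; rewrite vC; have /rowP/(_ i) := c0; rewrite !mxE => ->; rewrite mpolyC0.
Qed.

Theorem theorem5p6 (k : closedFieldType) (char0 : [pchar k] =i pred0)
    (a q : nat) (b : 'cV[coxring k]_q)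
    (basis_b : bigraded_basis (a, 1%N) b) :
  for_generic (fun C : 'M[k]_(4, q) =>
    lin_indep (combine C b) ->
    basepoint_free (combine C b) ->
    exists sg : 'I_2 -> 'rV[coxring k]_4,
      (forall j, syzygy (combine C b) (a, 0%N) (sg j)) /\
      first_map_determined_by (combine C b) a sg).
Proof.
have dims : (4 * a = 2 * (a + a))%N by rewrite addnn -mul2n mulnA.
have [P PE] := generic_row_free (@syzygy_mx k a q b) dims.
(* [P] does not vanish at [C] exactly when the system in degree a-1 is invertible; the witness shows
   that [P] is nonzero. *)
exists P => [|C _].
  have [C0] := syzygy_mx_free_witness basis_b; rewrite -PE.
  by apply: contraNneq => ->; rewrite meval0.
rewrite PE; set f := combine C b => freeC indep bpf.
have hf i : bihomog (a, 1)%N (f i 0) by apply: bihomog_combine.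
(* For [a = 0] truncated subtraction makes [2 * a - 1] equal to 0 and the proposed basis is empty,
   so constant syzygies must be shown to vanish; this is linear independence. *)
have [a0|a_gt0] := posnP a.
  subst a; exists (fun=> 0); split=> [j|].
    by split=> [i|]; [rewrite mxE; apply: bihomog0|rewrite mul0mx].
  split; last by move=> ? [].
  split; first by move=> ? [].
  move=> T ZT; exists 0; split=> [|c _]; last by apply/matrixP=> ? [].
  rewrite big1 => [|j _]; last by rewrite big_ord0.
  apply/rowP=> l; apply/mpolyP=> m; have /rowP/(_ l) := constant_syzygies indep (ZT m).
  by rewrite !mxE mcoeff0.
have sF := size_dehom_forms hf.
(* The leading coefficients have rank 2, so their left kernel has dimension 4 - 2 = 2, whence two
   syzygies. *)
have [|W freeW kerW] := @kernel_row_basis k 4 2 2 (coefmx a (dehom_forms f)).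
  by rewrite (bpf_leading_rank hf bpf).
have [s [ss ts ks]] := kernel_basis_exists sF dims freeC kerW.
exists (kernel_syzygy a s); split; first exact: kernel_syzygyP.
apply: kernel_syzygies_determine => //.
- by move=> T; apply: (kernel_basis_span sF freeC kerW ss ts ks).
- by move=> u; apply: (kernel_basis_free freeW ss ts).
Qed.
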